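(* For every rational number $s>1$, $g(s)=\frac{s+1}{2s}$.
   Context: Let $\mathbb{F}$ be a finite field and $x_1,\dots,x_p$ a basis of $\mathbb{F}^p$. A $[t\times m,p]$ array code is a $t\times m$ array whose entries (cells) are linear combinations of $x_1,\dots,x_p$. It has the $k$-PIR property (is a $[t\times m,p]$ $k$-PIR array code) if for every $i\in\{1,\dots,p\}$ there exist $k$ pairwise disjoint sets $S_1,\dots,S_k$ of columns such that for every $j$ the vector $x_i$ lies in the linear span of all entries of the columns in $S_j$. Its PIR rate is $k/m$. For a rational $s>1$ and a positive integer $t$ with $st$ an integer, $g(s,t)$ is the largest PIR rate $k/m$ of a $[t\times m,st]$ $k$-PIR array code (over all finite fields, all $m$ and all $k$), and $g(s)=\limsup_{t\to\infty} g(s,t)$, with $t$ ranging over positive integers such that $st$ is an integer. *)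

(* Defs.v *)
From HB Require Import structures.
From mathcomp Require Import all_boot all_order all_algebra all_field.
From mathcomp Require Import classical_sets reals.
Set Implicit Arguments. Unset Strict Implicit. Unset Printing Implicit Defensive.
Import Order.TTheory GRing.Theory Num.Theory.
Local Open Scope ring_scope.

(* A [t x m, p] array code over F: cell (r, c) holds a vector of F^p,
   i.e. the coordinates of a linear combination of the basis x_1..x_p
   (x_i is the i-th standard basis row vector delta_mx 0 i). *)
Definition array_code (F : finFieldType) (t m p : nat) := 'I_t -> 'I_m -> 'rV[F]_p.

Definition col_span (F : finFieldType) (t m p : nat) (C : array_code F t m p)
  (S : {set 'I_m}) : 'M[F]_p :=
  (\sum_(c in S) \sum_(r < t) <<C r c>>)%MS.

Definition is_PIR (F : finFieldType) (t m p : nat) (k : nat) (C : array_code F t m p) : Prop :=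
  forall i : 'I_p, exists S : 'I_k -> {set 'I_m},
    (forall a b : 'I_k, a != b -> [disjoint S a & S b]) /\
    (forall a : 'I_k, (delta_mx (0 : 'I_1) i <= col_span C (S a))%MS).

Local Open Scope classical_set_scope.

Definition PIR_rates (R : realType) (s : rat) (t : nat) : set R :=
  [set r | exists (p : nat) (F : finFieldType) (m k : nat) (C : array_code F t m p),
     [/\ (p%:R : rat) = s * t%:R, (0 < m)%N, (0 < k)%N, is_PIR k C & r = k%:R / m%:R]].

Definition g_st (R : realType) (s : rat) (t : nat) : R := sup (@PIR_rates R s t).

Definition adm_t (s : rat) (t : nat) : Prop := (0 < t)%N /\ exists p : nat, (p%:R : rat) = s * t%:R.

(* g(s) = limsup_{t -> oo, t admissible} g(s,t) = inf_N sup_{t >= N admissible} g(s,t) *)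
Definition g_s (R : realType) (s : rat) : R :=
  inf [set y | exists N : nat, y = sup [set @g_st R s t | t in [set t | (N <= t)%N /\ adm_t s t]]].

(* Main.v *)
Require Import Defs.
From HB Require Import structures.
From mathcomp Require Import all_boot all_order all_algebra all_field.
From mathcomp Require Import fingroup perm zify ring lra.
From mathcomp Require Import classical_sets reals.
Set Implicit Arguments.
Unset Strict Implicit.
Unset Printing Implicit Defensive.
Import Order.TTheory GRing.Theory Num.Theory.
Local Open Scope ring_scope.

(** Upper bound: if x_i lies in the span of alpha_i single columns, then every
    recovery set of x_i that is not one of these columns uses at least two
    columns, so 2k <= m + alpha_i. A column has dimension at most t, hence the
    alpha_i sum to at most mt, and 2pk <= m(p + t).

    Lower bound: fix r >= s and u = t - r. Cut the p positions into blocks of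
    length u; the positions of block 0 each get a cell of their own, and each
    other block (there are at most r of them once t >= r^2 + r) is summed into
    one cell. Fill the positions with x_1, ..., x_p in all p! orders sigma,
    taking each column twice. If i sits in block 0 of sigma, the column alone
    recovers x_i. Otherwise let q be the position of i and tau_q an involution
    fixing q and moving the rest of the block of q into block 0: one copy of
    sigma provides the sum of that block, and the other copy of sigma o tau_q
    provides all its terms but x_i. As sigma |-> sigma o tau_q preserves q, it
    is a bijection and these pairs are disjoint. The rate is (p + t - r)/(2p),
    which tends to (s + 1)/(2s). *)

(** * Upper bound: counting the columns that recover a symbol alone *)

Lemma cell_sub_col_span (F : finFieldType) (t m p : nat) (C : array_code F t m p)
  (S : {set 'I_m}) (r : 'I_t) (c : 'I_m) :
  c \in S -> (C r c <= col_span C S)%MS.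
Proof.
move=> cS; rewrite /col_span; apply: (sumsmx_sup c) => //.
by apply: (sumsmx_sup r) => //; rewrite genmxE.
Qed.

(** Distinct unit vectors are independent: the matrix [D] of those lying in [M] has right inverse
    [D^T]. *)
Lemma card_delta_mx_sub (F : fieldType) (n p : nat) (M : 'M[F]_(n, p)) :
  (#|[set i : 'I_p | (delta_mx (0%R : 'I_1) i <= M)%MS]%SET| <= \rank M)%N.
Proof.
set E := finset _.
pose D : 'M[F]_(#|E|, p) := \matrix_(a < #|E|) delta_mx 0 (enum_val a).
have DM : (D <= M)%MS.
  apply/row_subP => a; rewrite rowK.
  by have := enum_valP a; rewrite inE.
apply: leq_trans (mxrankS DM).
suff /eqP -> : row_free D by [].
apply/row_freeP; exists D^T; apply/matrixP => a b.
rewrite !mxE (bigD1 (enum_val a)) //= !mxE !eqxx mul1r big1 => [|j ja].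
  by rewrite addr0 (inj_eq enum_val_inj).
by rewrite !mxE (negbTE ja) mul0r.
Qed.

Lemma mxrank_col_span1 (F : finFieldType) (t m p : nat) (C : array_code F t m p)
  (c : 'I_m) : (\rank (col_span C [set c]%SET) <= t)%N.
Proof.
rewrite /col_span big_set1.
apply: leq_trans (mxrank_sum_leqif _) _ => /=.
rewrite -[X in (_ <= X)%N]card_ord -sum1_card; apply: leq_sum => r _.
by rewrite mxrank_gen rank_leq_row.
Qed.

Lemma sum_card_setI_disjoint (T : finType) (k : nat) (S : 'I_k -> {set T})
  (A : {set T}) :
  (forall a b, a != b -> [disjoint S a & S b]) ->
  (\sum_(a < k) #|(S a :&: A)%SET| <= #|A|)%N.
Proof.
move=> dS.
have -> : (\sum_(a < k) #|(S a :&: A)%SET| =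
           \sum_(x in A) \sum_(a < k) (x \in S a))%N.
  rewrite exchange_big /=; apply: eq_bigr => a _.
  rewrite -sum1_card (eq_bigl (fun x => (x \in A) && (x \in S a))).
    by rewrite -big_mkcondr.
  by move=> x; rewrite finset.in_setI andbC.
rewrite -[X in (_ <= X)%N]sum1_card; apply: leq_sum => x _.
rewrite -big_mkcond sum1_card.
apply/card_le1_eqP => a b xa xb.
apply/eqP/negPn/negP => /dS /pred0P /(_ x) /=.
by move: xa xb; rewrite !unfold_in => -> ->.
Qed.

Lemma PIR_rate_upper_bound (F : finFieldType) (t m p k : nat)
  (C : array_code F t m p) :
  is_PIR k C -> (2 * p * k <= m * (p + t))%N.
Proof.
move=> PIR.
pose rec (i : 'I_p) (c : 'I_m) :=
  (delta_mx (0 : 'I_1) i <= col_span C [set c]%SET)%MS.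
have bound i : (2 * k <= m + #|[set c | rec i c]%SET|)%N.
  have [S [dS spanS]] := PIR i; set A := finset _.
  (* A recovery set has at least two columns or is a single column of [A]; it is never empty, since
     [delta_mx 0 i] is nonzero. *)
  have cover a : (2 <= #|(S a :&: finset.setT)%SET| + #|(S a :&: A)%SET|)%N.
    rewrite finset.setIT; case: (ltngtP #|S a| 1%N) => [| |/eqP/cards1P[c Sc]].
    - rewrite ltnS leqn0 cards_eq0 => /eqP S0; have := spanS a.
      rewrite S0 /col_span big_set0 submx0 => /eqP/matrixP/(_ 0 i).
      by rewrite !mxE !eqxx => /eqP; rewrite oner_eq0.
    - by move=> ?; rewrite ltn_addr.
    - suff -> : (S a :&: A)%SET = S a by rewrite Sc cards1.
      by apply/finset.setIidPl; rewrite Sc finset.sub1set inE /rec -Sc spanS.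
  have := leq_sum (index_enum _) (P := xpredT) (fun a _ => cover a).
  rewrite sum_nat_const card_ord mulnC big_split /= => /leq_trans; apply.
  apply: leq_add; last exact: sum_card_setI_disjoint.
  by apply: leq_trans (sum_card_setI_disjoint _ _) _ => //; rewrite cardsT card_ord.
(* Double counting of the pairs [(i, c)]: a column of rank at most [t] recovers at most [t] unit
   vectors alone. *)
have total : (\sum_(i < p) #|[set c | rec i c]%SET| <= m * t)%N.
  have -> : (\sum_(i < p) #|[set c | rec i c]%SET| =
             \sum_(c < m) #|[set i | rec i c]%SET|)%N.
    under eq_bigr do rewrite -sum1dep_card big_mkcond /=.
    by rewrite exchange_big; apply: eq_bigr => c _; rewrite -sum1dep_card [RHS]big_mkcond.
  rewrite -[m in (_ <= m * _)%N]card_ord -sum_nat_const; apply: leq_sum => c _.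
  exact: leq_trans (card_delta_mx_sub _) (mxrank_col_span1 _ _).
have := leq_sum (index_enum _) (P := xpredT) (fun i _ => bound i).
rewrite sum_nat_const big_split /= sum_nat_const card_ord.
move: total; set X := bigop _ _ _; move: X => X; nia.
Qed.

(** * Lower bound: symmetrization over all permutations *)

Lemma is_PIR_fintype (F : finFieldType) (t p k : nat) (V : finType)
  (D : 'I_t -> V -> 'rV[F]_p) :
  (forall i : 'I_p, exists (A : {set V}) (S : V -> {set V}),
     [/\ (k <= #|A|)%N,
         {in A &, forall a b, a != b -> [disjoint S a & S b]} &
         {in A, forall a (M : 'M[F]_p),
            (forall r c, c \in S a -> (D r c <= M)%MS) ->
            (delta_mx (0 : 'I_1) i <= M)%MS}]) ->
  @is_PIR F t #|V| p k (fun r c => D r (enum_val c)).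
Proof.
move=> H i; have [A [S [kA dS spanS]]] := H i.
pose e (a : 'I_k) := enum_val (widen_ord kA a).
exists (fun a => [set c | enum_val c \in S (e a)]%SET); split=> [a b ab|a].
  have /dS : e a \in A by apply: enum_valP.
  move=> /(_ (e b) (enum_valP _)).
  rewrite (inj_eq enum_val_inj) => /(_ ab) /pred0P d.
  by apply/pred0P => c /=; rewrite !inE; apply: d.
apply: (spanS (e a)) => [|r v vS]; first exact: enum_valP.
have -> : D r v = (fun r c => D r (enum_val c)) r (enum_rank v).
  by rewrite /= enum_rankK.
by apply: cell_sub_col_span; rewrite inE enum_rankK.
Qed.

Lemma fact_pred (n : nat) : (0 < n)%N -> n`! = (n * (n.-1)`!)%N.
Proof. by case: n. Qed.

(** Composing with [tperm q q'] shows that the count does not depend on [q], and each permutation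
    takes the value [i] exactly once. *)
Lemma card_perm_eq_at (T : finType) (q i : T) :
  (#|T| * #|[set s : {perm T} | s q == i]%SET| = #|{perm T}|)%N.
Proof.
have cardE q' : #|[set s : {perm T} | s q' == i]%SET| =
                #|[set s : {perm T} | s q == i]%SET|.
  rewrite -(card_imset _ (mulgI (tperm q q'))); congr #|pred_of_set _|.
  apply/setP => s; rewrite inE; apply/imsetP/eqP => [[s']|sq].
    by rewrite inE => /eqP s'q ->; rewrite permM tpermL.
  exists (tperm q q' * s)%g; last by rewrite mulgA tperm2 mul1g.
  by rewrite inE permM tpermR sq.
rewrite -sum_nat_const.
under eq_bigr => q' _ do rewrite -(cardE q') -sum1dep_card big_mkcond /=.
rewrite exchange_big /= -[RHS]sum1_card; apply: eq_bigr => s _.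
rewrite -big_mkcond (big_pred1 ((s^-1)%g i)) // => q' /=.
by apply/eqP/eqP => [<-|->]; rewrite ?permK ?permKV.
Qed.

Section SymmetrizedArray.
Variables (F : finFieldType) (t p : nat) (cls : 'I_p -> 'I_t).
Variables (P0 : {set 'I_p}) (tau : 'I_p -> {perm 'I_p}).
Hypothesis cls_single : forall q q', q \in P0 -> cls q' = cls q -> q' = q.
Hypothesis tau_fix : forall q, tau q q = q.
Hypothesis tau_single : forall q q', q \notin P0 -> q' != q ->
  cls q' = cls q -> tau q q' \in P0.

Let V : finType := ({perm 'I_p} * bool)%type.

Definition symmetrized_cell (r : 'I_t) (v : V) : 'rV[F]_p :=
  \sum_(q | cls q == r) delta_mx 0 (v.1 q).

Let pos (i : 'I_p) (v : V) : 'I_p := (v.1^-1)%g i.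

Lemma symmetrized_cell_single q v :
  q \in P0 -> symmetrized_cell (cls q) v = delta_mx 0 (v.1 q).
Proof.
move=> qP; rewrite /symmetrized_cell (big_pred1 q) // => q'.
by apply/eqP/eqP => [/(cls_single qP)|->].
Qed.

(* [v.2] tells the two copies of a column apart: a recovery set consisting of
   two columns is indexed by its member of copy [false] only. *)
Definition recovery_index (i : 'I_p) : {set V} :=
  [set v | ~~ v.2 || (pos i v \in P0)]%SET.

(** The inverse of [tau] makes position [tau q q'] of the second column hold the symbol that [v.1]
    has at [q']. *)
Definition recovery_set (i : 'I_p) (v : V) : {set V} :=
  if pos i v \in P0 then [set v]%SET
  else [set (v.1, false); (((tau (pos i v))^-1 * v.1)%g, true)]%SET.

Lemma pos_recovery_set i v x : x \in recovery_set i v -> pos i x = pos i v.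
Proof.
rewrite /recovery_set; case: ifP => _; first by rewrite inE => /eqP->.
rewrite !inE => /orP[] /eqP-> //; rewrite /pos /= invMg invgK permM.
exact: tau_fix.
Qed.

(** Sets that meet share the position [q] of [i]. The common column then determines the index:
    directly, or after cancelling [(tau q)^-1] in copy [true]. *)
Lemma recovery_set_disjoint i :
  {in recovery_index i &, forall v w, v != w ->
    [disjoint recovery_set i v & recovery_set i w]}.
Proof.
move=> v w vA wA /eqP vw; apply/pred0P => x /=.
apply/negP => /andP[xv xw]; apply: vw.
have vwE : pos i v = pos i w.
  by rewrite -(pos_recovery_set xv) (pos_recovery_set xw).
move: xv xw vA wA; rewrite /recovery_set -vwE !inE -vwE; case: ifP => _.
  by rewrite !inE => /eqP <- /eqP <-.
rewrite !orbF; case: v w vwE => [v b] [w c] /= vwE xv xw /negbTE-> /negbTE->.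
move: xv xw; rewrite !inE => /orP[]/eqP-> /orP[] /eqP[] //.
  by move->.
by move/mulgI->.
Qed.

(** Copy [false] contributes all [p!] columns, and copy [true] contributes [(p-1)!] for each
    position in [P0]. *)
Lemma card_recovery_index i :
  (p * #|recovery_index i| = (p + #|P0|) * p`!)%N.
Proof.
have -> : (#|recovery_index i| = p`! +
    \sum_(q in P0) #|[set s : {perm 'I_p} | s q == i]%SET|)%N.
  have -> : (#|recovery_index i| =
             \sum_(s : {perm 'I_p}) \sum_(b : bool) ((s, b) \in recovery_index i))%N.
    by rewrite pair_bigA -sum1_card big_mkcond; apply: eq_bigr => -[s b].
  rewrite (eq_bigr (fun s : {perm 'I_p} => 1 + ((s^-1)%g i \in P0))%N); last first.
    by move=> s _; rewrite big_bool !inE /= /pos /=; case: (_ \in P0).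
  rewrite big_split /= sum1_card card_Sn; congr (_ + _)%N.
  under [RHS]eq_bigr => q _ do rewrite -sum1dep_card big_mkcond /=.
  rewrite [RHS]exchange_big /=; apply: eq_bigr => s _.
  have posE q : (s q == i) = (q == (s^-1)%g i).
    by apply/eqP/eqP => [<-|->]; rewrite ?permK ?permKV.
  rewrite -big_mkcondr; under eq_bigl do rewrite posE.
  case: (boolP ((s^-1)%g i \in P0)) => sP; [rewrite (big_pred1 ((s^-1)%g i)) | rewrite big_pred0] => // q /=.
    by case: eqP => [->|]; rewrite ?sP ?andbF.
  by case: eqP => [->|]; rewrite ?(negbTE sP) ?andbF.
rewrite mulnDr big_distrr /= (eq_bigr (fun=> p`!)) => [|q _]; last first.
  by have := card_perm_eq_at q i; rewrite card_ord card_Sn.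
by rewrite sum_nat_const mulnDl.
Qed.

Lemma recovery_set_span i v (M : 'M[F]_p) : v \in recovery_index i ->
  (forall r c, c \in recovery_set i v -> (symmetrized_cell r c <= M)%MS) ->
  (delta_mx (0 : 'I_1) i <= M)%MS.
Proof.
have posK (w : V) : w.1 (pos i w) = i by rewrite /pos permKV.
move=> _; rewrite /recovery_set; case: ifPn => qP HM.
  have := HM (cls (pos i v)) v; rewrite symmetrized_cell_single // posK.
  by apply; rewrite inE.
set q := pos i v in qP HM.
have H1 := HM (cls q) (v.1, false); have {HM} H2 r := HM r ((tau q)^-1 * v.1, true)%g.
have -> : delta_mx 0 i = symmetrized_cell (cls q) (v.1, false)
    - \sum_(q' | (cls q' == cls q) && (q' != q)) delta_mx 0 (v.1 q') :> 'rV[F]_p.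
  by rewrite /symmetrized_cell (bigD1 q) //= addrK posK.
apply: addmx_sub; first by apply: H1; rewrite !inE eqxx.
(* As [tau q q'] is in [P0], the term of [q'] is a whole cell of the second column. *)
rewrite eqmx_opp; apply: summx_sub => q' /andP[/eqP cq' q'q].
have := H2 (cls (tau q q')).
rewrite symmetrized_cell_single ?tau_single // permM permK; apply.
by rewrite !inE eqxx orbT.
Qed.

Lemma symmetrized_array_PIR : (0 < p)%N ->
  @is_PIR F t #|V| p ((p + #|P0|) * (p.-1)`!)
    (fun r c => symmetrized_cell r (enum_val c)).
Proof.
move=> p0; apply: is_PIR_fintype => i.
exists (recovery_index i), (recovery_set i); split.
- rewrite -(leq_pmul2l p0) card_recovery_index mulnCA.
  by rewrite (fact_pred p0).
- exact: recovery_set_disjoint.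
- by move=> v vA M; apply: recovery_set_span.
Qed.

Lemma card_symmetrized_columns : #|V| = (2 * p`!)%N.
Proof. by rewrite card_prod card_bool card_Sn mulnC. Qed.

End SymmetrizedArray.

(** * Block layout of the positions *)

(* Row of the cell holding position [q]: rows [0 .. u-1] hold one position
   each, row [u - 1 + j] holds the whole block [j >= 1]. *)
Definition block_row (u q : nat) : nat := if (q < u)%N then q else (u.-1 + q %/ u)%N.

(* Exchanges block 0 with the block of [q], except for the residue of [q]
   and for the positions whose partner would exceed [p]. *)
Definition block_swap (p u q e : nat) : nat :=
  if (e %% u == q %% u)%N then e
  else if (e < u)%N then (if (e + u * (q %/ u) < p)%N then e + u * (q %/ u) else e)%N
  else if (e %/ u == q %/ u)%N then (e %% u)%N else e.

(** Block 0 takes [u] rows, which leaves [t - u] rows for the other blocks; hence the capacity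
    [u * (t - u).+1]. *)
Lemma block_row_lt (t u p q : nat) : (0 < u)%N ->
  (p <= u * (t - u).+1)%N -> (u <= t)%N -> (q < p)%N -> (block_row u q < t)%N.
Proof.
move=> u0 pu ut qp; rewrite /block_row; case: (ltnP q u) => [qu|qu]; first by lia.
have : (q %/ u < (t - u).+1)%N by rewrite ltn_divLR // mulnC; apply: leq_trans pu.
move: (q %/ u)%N => d; lia.
Qed.

Lemma block_swap_lt (p u q e : nat) : (e < p)%N -> (block_swap p u q e < p)%N.
Proof.
move=> ep; rewrite /block_swap; do 3?case: ifP => //.
by move=> _ _ _; apply: leq_ltn_trans ep; apply: leq_mod.
Qed.

Lemma block_swapK (p u q e : nat) : (0 < u)%N -> (e < p)%N ->
  block_swap p u q (block_swap p u q e) = e.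
Proof.
move=> u0 ep; rewrite {2}/block_swap; case: eqP => [h|h].
  by rewrite /block_swap h eqxx.
case: ifP => eu.
  case: ifP => ep'; rewrite /block_swap; last by rewrite eu ep'; case: eqP.
  rewrite [(e + _)%N]addnC [(u * _)%N]mulnC modnMDl.
  case: eqP => // _; rewrite divnMDl // (divn_small eu) addn0 eqxx (modn_small eu).
  case: (ltnP (q %/ u * u + e) u) => // h2.
  have -> : (q %/ u = 0)%N by nia.
  by rewrite !(mul0n, muln0, add0n, addn0) if_same.
case: eqP => eq; rewrite /block_swap.
  rewrite modn_mod; case: eqP => // _; rewrite ltn_mod u0 -eq.
  by rewrite addnC mulnC -divn_eq ep.
by case: eqP => // _; rewrite eu; case: eqP.
Qed.

Lemma block_row_inj_small (u q q' : nat) : (q < u)%N ->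
  block_row u q' = block_row u q -> q' = q.
Proof.
move=> qu; rewrite /block_row qu; case: (ltnP q' u) => // uq' h.
have : (0 < q' %/ u)%N by rewrite divn_gt0 //; lia.
move: h; move: (q' %/ u)%N => d; lia.
Qed.

Lemma block_swap_small (p u q q' : nat) : (0 < u)%N -> (u <= q)%N -> q' != q ->
  block_row u q' = block_row u q -> (block_swap p u q q' < u)%N.
Proof.
move=> u0 uq q'q h.
have uq' : (u <= q')%N.
  rewrite leqNgt; apply/negP => q'u; move: q'q.
  by rewrite [q](block_row_inj_small q'u) ?eqxx.
move: h; rewrite /block_row !ltnNge uq uq' /= => /addnI h.
rewrite /block_swap !ltnNge uq' h eqxx /= -ltnNge; case: eqP => [h'|_]; last exact: ltn_pmod.
by move: q'q; rewrite (divn_eq q' u) (divn_eq q u) h h' eqxx.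
Qed.

Lemma exists_PIR_array (F : finFieldType) (t u p : nat) :
  (0 < u)%N -> (u <= t)%N -> (u <= p)%N -> (p <= u * (t - u).+1)%N ->
  exists (m k : nat) (C : array_code F t m p),
    [/\ (0 < m)%N, (0 < k)%N, is_PIR k C & (2 * p * k = m * (p + u))%N].
Proof.
move=> u0 ut up pu; have p0 : (0 < p)%N by apply: leq_trans up.
pose cls (q : 'I_p) := Ordinal (block_row_lt u0 pu ut (ltn_ord q)).
pose swap (q e : 'I_p) := Ordinal (block_swap_lt u q (ltn_ord e)).
have swapK q : involutive (swap q) by move=> e; apply: val_inj; exact: block_swapK.
pose tau q := perm (inv_inj (swapK q)).
pose P0 := [set q : 'I_p | (q < u)%N]%SET.
have cardP0 : #|P0| = u.
  by rewrite -sum1dep_card (big_ord_narrow up) sum1_card card_ord.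
have PIR : @is_PIR F t _ p _ _ := symmetrized_array_PIR F (cls := cls)
  (P0 := P0) (tau := tau) _ _ _ p0.
exists #|{: {perm 'I_p} * bool}|, ((p + #|P0|) * (p.-1)`!)%N.
eexists; split; last first.
- rewrite card_symmetrized_columns cardP0 (fact_pred p0); lia.
- apply: PIR.
  + by move=> q q'; rewrite inE => qu /(congr1 val) /(block_row_inj_small qu) /val_inj.
  + by move=> q; rewrite permE; apply: val_inj; rewrite /= /block_swap eqxx.
  + move=> q q'; rewrite inE -leqNgt => uq q'q /(congr1 val) /= h.
    by rewrite inE permE /=; apply: block_swap_small.
- by rewrite muln_gt0 addn_gt0 p0 fact_gt0.
- by rewrite card_symmetrized_columns muln_gt0 fact_gt0.
Qed.

Lemma limit_rate_eq (s : rat) (t p : nat) : 0 < s -> (0 < t)%N ->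
  (p%:R : rat) = s * t%:R ->
  (s + 1) / (2 * s) = (p + t)%:R / (2 * p)%:R.
Proof.
move=> s0 t0 hp.
rewrite natrD natrM hp; field.
by rewrite (gt_eqF s0) pnatr_eq0 -lt0n t0.
Qed.

Lemma PIR_rates_ub (R : realType) (s : rat) (t : nat) : 1 < s -> (0 < t)%N ->
  ubound (@PIR_rates R s t) (ratr ((s + 1) / (2 * s))).
Proof.
move=> s1 t0 _ [p [F [m [k [C [hp m0 k0 PIR ->]]]]]].
have s0 : 0 < s by apply: lt_trans s1.
have p0 : (0 < p)%N by rewrite -(ltr_nat rat) hp mulr_gt0 // ltr0n.
rewrite -(ratr_nat R k) -(ratr_nat R m) -fmorph_div ler_rat (limit_rate_eq s0 t0 hp).
rewrite ler_pdivrMr ?ltr0n // mulrAC ler_pdivlMr ?ltr0n ?muln_gt0 ?p0 //.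
rewrite -!natrM ler_nat; have := PIR_rate_upper_bound PIR; lia.
Qed.

Lemma g_st_le (R : realType) (s : rat) (t : nat) : 1 < s -> (0 < t)%N ->
  @g_st R s t <= ratr ((s + 1) / (2 * s)).
Proof.
move=> s1 t0; rewrite /g_st.
have [->|/set0P ne] := eqVneq (@PIR_rates R s t) set0.
  rewrite sup0 ler0q divr_ge0 //; lra.
exact: ge_sup (PIR_rates_ub s1 t0).
Qed.

Lemma g_st_ge (R : realType) (s : rat) (t p r : nat) : 1 < s -> s <= r%:R ->
  (r ^ 2 + r <= t)%N -> (p%:R : rat) = s * t%:R ->
  ratr ((s + 1) / (2 * s)) - r%:R / (2 * p%:R) <= @g_st R s t.
Proof.
move=> s1 sr rt hp.
have s0 : 0 < s by apply: lt_trans s1.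
have r1 : (1 < r)%N by rewrite -(ltr_nat rat); apply: lt_le_trans sr.
have t0 : (0 < t)%N by lia.
have tp : (t < p)%N by rewrite -(ltr_nat rat) hp ltr_pMl // ltr0n.
have pr : (p <= r * t)%N by rewrite -(ler_nat rat) hp natrM ler_wpM2r.
have rlt : (r < t)%N by nia.
have [|||| m [k [C [m0 k0 PIR rate]]]] := @exists_PIR_array 'F_2 t (t - r) p.
- by rewrite subn_gt0.
- exact: leq_subr.
- by lia.
- rewrite (subKn (ltnW rlt)); apply: leq_trans pr _; rewrite mulnBl !mulnS.
  move: rt; rewrite expnS expn1 [(t * r)%N]mulnC; lia.
have -> : ratr ((s + 1) / (2 * s)) - r%:R / (2 * p%:R) = k%:R / m%:R :> R.
  rewrite (limit_rate_eq s0 t0 hp) [ratr _]fmorph_div /= !ratr_nat natrM -mulrBl.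
  have -> : (p + t)%:R - r%:R = (p + (t - r))%:R :> R.
    by rewrite addnBA 1?ltnW // natrB //; lia.
  apply/eqP; rewrite eqr_div ?mulf_neq0 ?pnatr_eq0 -?lt0n //; last by lia.
  by rewrite -!natrM eqr_nat; apply/eqP; lia.
apply: ub_le_sup; first by exists (ratr ((s + 1) / (2 * s))); apply: PIR_rates_ub.
by exists p, 'F_2, m, k, C.
Qed.

Lemma adm_t_unbounded (s : rat) : 1 < s ->
  forall N : nat, exists t p : nat,
    [/\ (N <= t)%N, (N <= p)%N, (0 < t)%N & (p%:R : rat) = s * t%:R].
Proof.
move=> s1 N; have s0 : 0 < s by apply: lt_trans s1.
pose b := `|denq s|%N; have b0 : (0 < b)%N by rewrite absz_gt0 denq_neq0.
pose a := `|numq s|%N; have a0 : (0 < a)%N by rewrite absz_gt0 numq_eq0 gt_eqF.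
exists (b * N.+1)%N, (a * N.+1)%N; split; try nia.
have -> : s = a%:R / b%:R.
  rewrite -{1}[s]divq_num_den; congr (_ / _).
    by rewrite /a natr_absz gtr0_norm // numq_gt0.
  by rewrite /b natr_absz gtr0_norm.
by rewrite !natrM; field; rewrite pnatr_eq0 -lt0n.
Qed.

Lemma sup_g_st_tail (R : realType) (s : rat) (N : nat) : 1 < s ->
  sup [set @g_st R s t | t in [set t | (N <= t)%N /\ adm_t s t]]%classic
  = ratr ((s + 1) / (2 * s)).
Proof.
move=> s1; set B := ratr _; set E := image _ _.
have ubE : ubound E B by move=> _ [t [_ [t0 _]] <-]; apply: g_st_le.
have neE : (E !=set0)%classic.
  have [t [p [Nt _ t0 hp]]] := adm_t_unbounded s1 N.
  by exists (@g_st R s t), t => //; split=> //; split=> //; exists p.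
apply/eqP; rewrite eq_le ge_sup //=.
have [r sr] : exists r : nat, s <= r%:R.
  by exists (Num.bound s); apply/ltW/archi_boundP/ltW; apply: lt_trans s1.
apply/ler_addgt0Pr => e e0.
have [n nr] : exists n : nat, r%:R / e < n%:R.
  by exists (Num.bound (r%:R / e)); apply: archi_boundP; rewrite divr_ge0 // ltW.
have [t [p [Nt Np t0 hp]]] := adm_t_unbounded s1 (N + (r ^ 2 + r) + n.+1)%N.
have p0 : 0 < p%:R :> R by rewrite ltr0n; lia.
have rp : r%:R / (2 * p%:R) <= e.
  rewrite ler_pdivrMr ?mulr_gt0 //; move: nr; rewrite ltr_pdivrMr // => /ltW/le_trans; apply.
  rewrite mulrC ler_pM2l //; have : n%:R <= p%:R :> R by rewrite ler_nat; lia.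
  by move: p0; lra.
rewrite -lerBlDr; apply: le_trans (_ : @g_st R s t <= _).
  apply: le_trans (@g_st_ge R s t p r s1 sr _ hp); last by lia.
  by rewrite lerD2l lerN2.
apply: ub_le_sup; first by exists B.
by exists t => //; split; [lia | split=> //; exists p].
Qed.

Unset Implicit Arguments.

Theorem theorem13 (R : realType) (s : rat) (hs : 1 < s) :
  @g_s R s = ratr ((s + 1) / (2 * s)).
Proof.
rewrite /g_s -[RHS]inf1; congr inf; apply/seteqP; split=> [_ [N ->]|_ ->] /=.
  exact: sup_g_st_tail.
by exists 0%N; rewrite sup_g_st_tail.
Qed.
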